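(* Let $(A,(,,),\alpha)$ be a ternary totally Hom-associative algebra with equal twisting maps (both equal to $\alpha$). Define the triple product $$[xyz]=(xyz)-(yxz)-(zxy)+(zyx)$$ for $x,y,z\in A$. Then $L(A)=(A,[,,],\alpha)$ is a Hom-Lie triple system. Moreover, if $A$ is multiplicative, then so is $L(A)$.
   Context: We work over a fixed field $\mathbf{k}$ of characteristic $0$. A ternary Hom-algebra $(V,(,,),(\alpha_1,\alpha_2))$ consists of a $\mathbf{k}$-module $V$, a trilinear map $(,,)\colon V^{\otimes 3}\to V$, written $(xyz)$, and linear maps $\alpha_1,\alpha_2\colon V\to V$ (the twisting maps). When $\alpha_1=\alpha_2=\alpha$ we write $(V,(,,),\alpha)$. It is multiplicative if $\alpha_1=\alpha_2=\alpha$ and $\alpha\circ(,,)=(,,)\circ\alpha^{\otimes 3}$. The triple product may be denoted by other brackets. A ternary totally Hom-associative algebra is a ternary Hom-algebra with $((uvw)\alpha_1(x)\alpha_2(y))=(\alpha_1(u)(vwx)\alpha_2(y))=(\alpha_1(u)\alpha_2(v)(wxy))$ for all $u,v,w,x,y$. A Hom-Lie triple system is a ternary Hom-algebra $(L,[,,],(\alpha_1,\alpha_2))$ with $[uvw]=-[vuw]$, $[uvw]+[wuv]+[vwu]=0$, and $$[\alpha_1(x)\alpha_2(y)[uvw]]=[[xyu]\alpha_1(v)\alpha_2(w)]+[\alpha_1(u)[xyv]\alpha_2(w)]+[\alpha_1(u)\alpha_2(v)[xyw]]$$ for all $u,v,w,x,y\in L$. *)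

(* Defs.v *)
From HB Require Import structures.
From mathcomp Require Import all_boot all_order all_algebra.

Set Implicit Arguments.
Unset Strict Implicit.
Unset Printing Implicit Defensive.

Import GRing.Theory.
Local Open Scope ring_scope.

Definition trilinear (k : fieldType) (V : lmodType k) (mu : V -> V -> V -> V) :
    Prop :=
  [/\ forall y z, linear (fun x => mu x y z),
      forall x z, linear (fun y => mu x y z)
    & forall x y, linear (fun z => mu x y z)].

(* A ternary Hom-algebra (V, mu, (a1, a2)) is kept unbundled: the linearity  *)
(* of the twisting maps is carried by their type, and the trilinearity of the *)
(* product is the first field of each of the two structures below.            *)
Definition hom_multiplicative (k : fieldType) (V : lmodType k)
    (mu : V -> V -> V -> V) (a1 a2 : {linear V -> V}) : Prop :=
  a1 =1 a2 /\ forall x y z, a1 (mu x y z) = mu (a1 x) (a1 y) (a1 z).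

Record totally_hom_associative (k : fieldType) (V : lmodType k)
    (mu : V -> V -> V -> V) (a1 a2 : {linear V -> V}) : Prop := {
  tha_trilinear : trilinear mu;
  tha_assocl : forall u v w x y,
    mu (mu u v w) (a1 x) (a2 y) = mu (a1 u) (mu v w x) (a2 y);
  tha_assocr : forall u v w x y,
    mu (a1 u) (mu v w x) (a2 y) = mu (a1 u) (a2 v) (mu w x y)
}.

Record hom_lie_triple_system (k : fieldType) (V : lmodType k)
    (br : V -> V -> V -> V) (a1 a2 : {linear V -> V}) : Prop := {
  hlts_trilinear : trilinear br;
  hlts_antisym : forall u v w, br u v w = - br v u w;
  hlts_jacobi : forall u v w, br u v w + br w u v + br v w u = 0;
  hlts_nambu : forall u v w x y,
    br (a1 x) (a2 y) (br u v w) =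
      br (br x y u) (a1 v) (a2 w) + br (a1 u) (br x y v) (a2 w)
      + br (a1 u) (a2 v) (br x y w)
}.

Definition lie_triple_product (k : fieldType) (V : lmodType k)
    (mu : V -> V -> V -> V) (x y z : V) : V :=
  mu x y z - mu y x z - mu z x y + mu z y x.

(* Main.v *)
(* Writing c for the formal commutator xy - yx, the product [xyz] is the
   commutator of c with z. Total Hom-associativity reassociates all products
   of five elements, so [x y -] is a twisted derivation of the associative
   triple product, and a twisted derivation of that product is one of [,,]. *)
Require Import Defs.
From mathcomp Require Import all_boot all_order all_algebra.

Import GRing.Theory.
Local Open Scope ring_scope.

Section LinearPredicate.

Context {k : fieldType} {V W : lmodType k}.

(** [trilinear] speaks of bare functions, so closure of [linear] under signed sums is needed for
    unbundled maps. *)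
Lemma linear_addf (f g : V -> W) :
  linear f -> linear g -> linear (fun x => f x + g x).
Proof. by move=> lf lg a x y; rewrite lf lg scalerDr addrACA. Qed.

Lemma linear_oppf (f : V -> W) : linear f -> linear (fun x => - f x).
Proof. by move=> lf a x y; rewrite lf opprD scalerN. Qed.

Lemma linear_fun_add {f : V -> W} : linear f -> {morph f : x y / x + y}.
Proof. by move=> lf x y; have := lf 1 x y; rewrite !scale1r. Qed.

Lemma linear_fun_opp {f : V -> W} : linear f -> {morph f : x / - x}.
Proof.
move=> lf x; have f0 : f 0 = 0.
  by apply: (addrI (f 0)); rewrite -linear_fun_add // !addr0.
by apply: (addrI (f x)); rewrite -linear_fun_add // !subrr.
Qed.

End LinearPredicate.

Section LieTripleProduct.

Variables (k : fieldType) (A : lmodType k) (mu : A -> A -> A -> A).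

Local Notation br := (lie_triple_product mu).

Lemma lie_triple_product_trilinear : trilinear mu -> trilinear br.
Proof.
case=> l1 l2 l3.
by split=> x y; do !(apply: linear_addf || apply: linear_oppf);
   first [exact: l1 | exact: l2 | exact: l3].
Qed.

Lemma lie_triple_product_antisym u v w : br u v w = - br v u w.
Proof.
rewrite /lie_triple_product !opprD !opprK.
by rewrite [LHS](ACl (2*1*4*3)).
Qed.

Lemma lie_triple_product_jacobi u v w : br u v w + br w u v + br v w u = 0.
Proof.
rewrite /lie_triple_product.
(* Each of the six orderings of [u], [v], [w] occurs twice, with opposite signs. *)
rewrite [LHS](AC (4*4*4) ((1*11)*(2*8)*(3*5)*(4*10)*(6*12)*(7*9))) /=.
by rewrite !(subrr, addNr, addr0).
Qed.

Lemma lie_triple_product_morph (f : {linear A -> A}) :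
  (forall x y z, f (mu x y z) = mu (f x) (f y) (f z)) ->
  forall x y z, f (br x y z) = br (f x) (f y) (f z).
Proof.
by move=> fM x y z; rewrite /lie_triple_product linearD !linearB /= !fM.
Qed.

Section TwistedDerivation.

Variables (f D E : A -> A).
Hypothesis E_linear : linear E.
Hypothesis E_mu : forall u v w,
  E (mu u v w) = mu (D u) (f v) (f w) + mu (f u) (D v) (f w)
                 + mu (f u) (f v) (D w).

(** The rule for [mu] keeps its form when the arguments are permuted, and [br] is a signed sum of
    permuted copies of [mu]. [E] is kept apart from [D] because the Nambu identity brackets with
    twisted elements outside and untwisted ones inside. *)
Lemma lie_triple_product_derivation u v w :
  E (br u v w) = br (D u) (f v) (f w) + br (f u) (D v) (f w)
                 + br (f u) (f v) (D w).
Proof.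
have [ED EN] := (linear_fun_add E_linear, linear_fun_opp E_linear).
rewrite /lie_triple_product !(ED, EN) !E_mu !opprD.
(* Regroup the twelve terms by the argument that [D] hits. *)
by rewrite [LHS](AC (3*3*3*3) ((1*5*8*12)*(2*4*9*11)*(3*6*7*10))).
Qed.

End TwistedDerivation.

Variable alpha : {linear A -> A}.
Hypothesis A_assoc : totally_hom_associative mu alpha alpha.

(** With c = xy - yx, the sum (cu - uc)vw + u(cv - vc)w + uv(cw - wc) telescopes to c(uvw) -
    (uvw)c. *)
Lemma lie_triple_product_inner_derivation x y u v w :
  br (alpha x) (alpha y) (mu u v w) =
    mu (br x y u) (alpha v) (alpha w) + mu (alpha u) (br x y v) (alpha w)
    + mu (alpha u) (alpha v) (br x y w).
Proof.
case: A_assoc => -[l1 l2 l3] al ar.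
have [D1 N1] := (fun y z => linear_fun_add (l1 y z),
                 fun y z => linear_fun_opp (l1 y z)).
have [D2 N2] := (fun x z => linear_fun_add (l2 x z),
                 fun x z => linear_fun_opp (l2 x z)).
have [D3 N3] := (fun x y => linear_fun_add (l3 x y),
                 fun x y => linear_fun_opp (l3 x y)).
(* Every fivefold product reaches the normal form [mu (alpha a) (alpha b) (mu c d e)], so it can be
   compared as a word. *)
rewrite /lie_triple_product !(D1, N1, D2, N2, D3, N3) !al !ar.
(* The words with [x] and [y] strictly inside [u v w] cancel in pairs. *)
rewrite [RHS](AC (4*4*4) ((1*2*11*12)*((3*5)*(4*6)*(7*9)*(8*10)))) /=.
by rewrite !(subrr, addNr, addr0).
Qed.

Lemma lie_triple_product_hom_lie : hom_lie_triple_system br alpha alpha.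
Proof.
have br_linear := lie_triple_product_trilinear (tha_trilinear A_assoc).
split=> //.
- exact: lie_triple_product_antisym.
- exact: lie_triple_product_jacobi.
move=> u v w x y; case: br_linear => _ _ br_linear.
(* The outer operator [E], left to unification, is [br (alpha x) (alpha y)]. *)
apply: (lie_triple_product_derivation alpha (br x y) _ (br_linear _ _)) => *.
exact: lie_triple_product_inner_derivation.
Qed.

End LieTripleProduct.

Theorem corollary4p3 (k : fieldType) (k_char0 : [pchar k] =i pred0)
    (A : lmodType k) (mu : A -> A -> A -> A) (alpha : {linear A -> A})
    (A_assoc : totally_hom_associative mu alpha alpha) :
  hom_lie_triple_system (lie_triple_product mu) alpha alpha /\
  (hom_multiplicative mu alpha alpha ->
   hom_multiplicative (lie_triple_product mu) alpha alpha).
Proof.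
split=> [|[_ alphaM]]; first exact: lie_triple_product_hom_lie.
by split=> //; apply: lie_triple_product_morph.
Qed.
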